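(* For $0\le n<\omega$, every topological group in $\mathrm{SSGP}(n)$ is in $\mathrm{SSGP}(n+1)$; that is, $\mathrm{SSGP}(n)\subseteq\mathrm{SSGP}(n+1)$. Hence $\mathrm{SSGP}(n)\subseteq\mathrm{SSGP}(m)$ whenever $n<m<\omega$.
   Context: All topological groups are assumed Hausdorff (equivalently, Tychonoff). $1_G$ denotes the identity of $G$, $\mathcal N(1_G)$ the set of neighborhoods of $1_G$ in $G$, and $\langle A\rangle$ the subgroup generated by $A$. The classes $\mathrm{SSGP}(n)$, $0\le n<\omega$, of (Hausdorff) topological groups are defined recursively: (a) $G\in\mathrm{SSGP}(0)$ if $G$ is the trivial group; (b) for $n\ge 0$, $G\in\mathrm{SSGP}(n+1)$ if for every $U\in\mathcal N(1_G)$ there is a family $\mathcal H$ of subgroups of $G$ such that (1) every member of $\mathcal H$ is contained in $U$, (2) $H:=\overline{\langle\bigcup\mathcal H\rangle}$ is normal in $G$, and (3) the quotient topological group $G/H$ is in $\mathrm{SSGP}(n)$. *)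

(* Defs.v *)
From HB Require Import structures.
From mathcomp Require Import all_boot all_classical.
From mathcomp Require Import topology.

Set Implicit Arguments.
Unset Strict Implicit.
Unset Printing Implicit Defensive.

Local Open Scope classical_set_scope.
Local Open Scope quotient_scope.
Local Open Scope group_scope.

(* Topological groups are Hausdorff by convention, so the separation axiom is
   part of the structure. *)
HB.mixin Record isTopologicalGroup G & Group G & Topological G := {
  mulg_continuous : continuous (fun xy : G * G => xy.1 * xy.2);
  invg_continuous : continuous (fun x : G => x^-1);
  topgroup_hausdorff : hausdorff_space G
}.

#[short(type="topologicalGroupType")]
HB.structure Definition TopologicalGroup :=
  {G of isTopologicalGroup G & Group G & Topological G}.

Definition is_subgroup (G : groupType) (K : set G) : Prop :=
  [/\ K 1, (forall x y, K x -> K y -> K (x * y))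
    & (forall x, K x -> K x^-1)].

Definition is_normal (G : groupType) (K : set G) : Prop :=
  forall x y, K x -> K (x ^ y).

Definition generated_subgroup (G : groupType) (A : set G) : set G :=
  smallest (@is_subgroup G) A.

Lemma generated_is_subgroup (G : groupType) (A : set G) :
  is_subgroup (generated_subgroup A).
Proof.
split=> [K [[]]//|x y xA yA K KA|x xA K KA].
- by have [[_ + _] _] := KA; apply; [exact: xA|exact: yA].
- by have [[_ _ +] _] := KA; apply; exact: xA.
Qed.

Record closedNormalSubgroup (G : topologicalGroupType) := ClosedNormalSubgroup {
  cns_set :> set G;
  cns_subgroup : is_subgroup cns_set;
  cns_closed : closed cns_set;
  cns_normal : is_normal cns_set
}.

Section ClosureSubgroup.
Variable G : topologicalGroupType.
Implicit Types (K : set G) (x y : G).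

Lemma nbhs_mulg x y (W : set G) : nbhs (x * y) W ->
  exists A B, [/\ nbhs x A, nbhs y B & forall a b, A a -> B b -> W (a * b)].
Proof.
move=> /(@mulg_continuous G (x, y)) [[A B] [/= xA yB] ABW].
by exists A, B; split=> // a b Aa Bb; exact: (ABW (a, b)).
Qed.

Lemma nbhs_invg x (W : set G) : nbhs x^-1 W -> nbhs x [set a | W a^-1].
Proof. exact: invg_continuous. Qed.

Lemma closure_is_subgroup K : is_subgroup K -> is_subgroup (closure K).
Proof.
move=> [K1 KM KV]; split; first exact: subset_closure.
- move=> x y xK yK W /nbhs_mulg[A [B [xA yB ABW]]].
  have [a [Ka Aa]] := xK _ xA; have [b [Kb Bb]] := yK _ yB.
  by exists (a * b); split; [exact: KM|exact: ABW].
- by move=> x xK W /nbhs_invg/xK[a [Ka Wa]]; exists a^-1; split=> //; exact: KV.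
Qed.

Definition closure_generated (A : set G)
    (nA : is_normal (closure (generated_subgroup A))) :
  closedNormalSubgroup G :=
  ClosedNormalSubgroup (closure_is_subgroup (generated_is_subgroup A))
    (@closed_closure _ _) nA.

End ClosureSubgroup.

Section Quotient.
Variables (G : topologicalGroupType) (H : closedNormalSubgroup G).
Implicit Types x y : G.

Definition same_coset : rel G := fun x y => `[< (H : set G) (x^-1 * y) >].

Lemma same_cosetP x y : reflect (exists2 h, (H : set G) h & y = x * h) (same_coset x y).
Proof.
apply: (iffP (asboolP _)) => [Hxy|[h Hh ->]]; last by rewrite mulKg.
by exists (x^-1 * y); rewrite // mulVKg.
Qed.

Lemma same_coset_equiv : equiv_class_of same_coset.
Proof.
have [H1 HM HV] := cns_subgroup H.
have sym x y : same_coset x y -> same_coset y x.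
  by move=> /asboolP/HV Hxy; apply/asboolP; rewrite invgM invgK in Hxy.
split=> [x|x y|y x z].
- by apply/asboolP; rewrite mulVg.
- by apply/idP/idP; exact: sym.
- move=> /asboolP Hxy /asboolP Hyz; apply/asboolP.
  by have := HM _ _ Hxy Hyz; rewrite mulgA mulgK.
Qed.

Canonical same_coset_rel := EquivRelPack same_coset_equiv.

Definition quotient_group : Type :=
  quotient_topology {eq_quot same_coset_rel}.

HB.instance Definition _ := Quotient.on quotient_group.
HB.instance Definition _ := Topological.on quotient_group.

Local Notation Q := quotient_group.

Definition coset (x : G) : Q := \pi_Q x.

Lemma cosetP x y : coset x = coset y <-> exists2 h, (H : set G) h & y = x * h.
Proof.
split=> [/eqmodP/same_cosetP//|xy].
by apply/eqmodP; exact/same_cosetP.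
Qed.

Lemma coset_repr (q : Q) : coset (repr q) = q. Proof. exact: reprK. Qed.

Lemma coset_surj (q : Q) : exists x, q = coset x.
Proof. by exists (repr q); rewrite coset_repr. Qed.

Definition coset_mul (p q : Q) : Q := coset (repr p * repr q).
Definition coset_inv (p : Q) : Q := coset (repr p)^-1.

Lemma coset_mulE x y : coset_mul (coset x) (coset y) = coset (x * y).
Proof.
have [_ HM _] := cns_subgroup H; rewrite /coset_mul.
have /cosetP[h Hh ->] : coset x = coset (repr (coset x)) by rewrite coset_repr.
have /cosetP[k Hk ->] : coset y = coset (repr (coset y)) by rewrite coset_repr.
symmetry; apply/cosetP; exists (h ^ y * k).
  by apply: HM => //; exact: cns_normal.
by rewrite conjgE !mulgA mulgK.
Qed.

Lemma coset_invE x : coset_inv (coset x) = coset x^-1.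
Proof.
have [_ _ HV] := cns_subgroup H; rewrite /coset_inv.
have /cosetP[h Hh ->] : coset x = coset (repr (coset x)) by rewrite coset_repr.
symmetry; apply/cosetP; exists (h^-1 ^ x^-1).
  by apply: cns_normal; exact: HV.
by rewrite conjgE invgK !mulgA mulVg mul1g invgM.
Qed.

Fact coset_mulA : associative coset_mul.
Proof.
move=> p q r; have [x ->] := coset_surj p; have [y ->] := coset_surj q.
by have [z ->] := coset_surj r; rewrite !coset_mulE mulgA.
Qed.
Fact coset_mul1 : left_id (coset 1) coset_mul.
Proof. by move=> p; have [x ->] := coset_surj p; rewrite coset_mulE mul1g. Qed.
Fact coset_1mul : right_id (coset 1) coset_mul.
Proof. by move=> p; have [x ->] := coset_surj p; rewrite coset_mulE mulg1. Qed.
Fact coset_mulV : left_inverse (coset 1) coset_inv coset_mul.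
Proof.
by move=> p; have [x ->] := coset_surj p; rewrite coset_invE coset_mulE mulVg.
Qed.
Fact coset_Vmul : right_inverse (coset 1) coset_inv coset_mul.
Proof.
by move=> p; have [x ->] := coset_surj p; rewrite coset_invE coset_mulE mulgV.
Qed.

HB.instance Definition _ := isGroup.Build Q
  coset_mulA coset_mul1 coset_1mul coset_mulV coset_Vmul.

Lemma cosetM x y : coset (x * y) = coset x * coset y.
Proof. by rewrite -coset_mulE. Qed.

Lemma cosetV x : coset x^-1 = (coset x)^-1.
Proof. by rewrite -coset_invE. Qed.

Lemma coset_continuous : continuous coset.
Proof. exact: pi_continuous. Qed.

Lemma coset_nbhs x (A : set G) : nbhs x A -> nbhs (coset x) (coset @` A).
Proof.
rewrite nbhsE => -[B [oB Bx] BA]; rewrite nbhsE /=.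
exists (coset @` B); last exact: image_subset.
split; last by exists x.
suff : open (coset @^-1` (coset @` B)) by [].
rewrite openE => z [b Bb] /cosetP[h Hh ->].
have : nbhs (b * h * h^-1) B by rewrite mulgK; exact: open_nbhs_nbhs.
move=> /nbhs_mulg[C [D [bhC hD CDB]]]; apply: filterS bhC => c Cc.
have [_ _ HV] := cns_subgroup H.
exists (c * h^-1); first by apply: CDB => //; exact: nbhs_singleton.
by apply/cosetP; exists h => //; rewrite mulgVK.
Qed.

Fact quotient_mulg_continuous : continuous (fun pq : Q * Q => pq.1 * pq.2).
Proof.
move=> [p q] W /=; have [x ->] := coset_surj p; have [y ->] := coset_surj q.
rewrite -cosetM => /coset_continuous/nbhs_mulg[A [B [xA yB ABW]]].
exists (coset @` A, coset @` B); first by split; exact: coset_nbhs.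
by move=> [_ _] [/= [a Aa <-] [b Bb <-]]; rewrite -cosetM; exact: ABW.
Qed.

Fact quotient_invg_continuous : continuous (fun p : Q => p^-1).
Proof.
move=> p W; have [x ->] := coset_surj p.
rewrite -cosetV => /coset_continuous/nbhs_invg/coset_nbhs.
by apply: filterS => _ [a Wa <-] /=; rewrite -cosetV.
Qed.

Fact quotient_hausdorff : hausdorff_space Q.
Proof.
have [H1 HM HV] := cns_subgroup H.
move=> p q; have [x ->] := coset_surj p; have [y ->] := coset_surj q => cl.
apply/cosetP; exists (x^-1 * y); last by rewrite mulVKg.
apply: cns_closed => W /nbhs_mulg[A [B [/nbhs_invg]]].
move=> xA yB ABW.
have [_ [[a /= Aa <-] [b Bb /cosetP[h Hh bah]]]] :=
  cl _ _ (coset_nbhs xA) (coset_nbhs yB).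
exists (a^-1 * b); split; last exact: ABW.
by rewrite bah invgM mulgVK //; exact: HV.
Qed.

HB.instance Definition _ := isTopologicalGroup.Build Q
  quotient_mulg_continuous quotient_invg_continuous quotient_hausdorff.

End Quotient.

(* The quotient needs a proof of normality, hence the dependent [exists nF]:
   normality of the closed subgroup is condition (2), and what follows it is
   condition (3); closedness and the subgroup axioms hold automatically. *)
Fixpoint SSGP (n : nat) (G : topologicalGroupType) : Prop :=
  if n is m.+1 then
    forall U : set G, nbhs 1 U ->
      exists F : set (set G),
        [/\ F `<=` @is_subgroup G,
            forall K, F K -> K `<=` U
          & exists nF : is_normal
                (closure (generated_subgroup (\bigcup_(K in F) K))),
              SSGP m (quotient_group (closure_generated nF))]
  else forall x : G, x = 1.

(* Main.v *)
Require Import Defs.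
From mathcomp Require Import all_boot.
From mathcomp Require Import all_classical.
From mathcomp Require Import topology.

(** Induction on [n], for all groups at once: a family [F] witnessing one level for [U] also
    witnesses the next, since its quotient moves up a level by induction. At the bottom, the empty
    family works: a quotient of the trivial group is trivial. *)

Lemma SSGP_succ (n : nat) (G : topologicalGroupType) : SSGP n G -> SSGP n.+1 G.
Proof.
elim: n G => [|n IHn] G.
- move=> G1 U _; exists set0; split=> //.
  have nF : is_normal (closure (generated_subgroup (\bigcup_(K in @set0 (set G)) K))).
    by move=> x y; rewrite (G1 (x ^ y)%g) (G1 x).
  exists nF => q; have [x ->] := coset_surj q.
  by rewrite (G1 x).
- move=> SG U /SG[F [Fsub FU [nF SQ]]].
  by exists F; split=> //; exists nF; exact: IHn.
Qed.

Theorem mainTheorem1 :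
  (forall (n : nat) (G : topologicalGroupType), SSGP n G -> SSGP n.+1 G) /\
  (forall (n m : nat), n < m ->
     forall (G : topologicalGroupType), SSGP n G -> SSGP m G).
Proof.
split=> [|n m /ltnW/subnK <- G SG]; first exact: SSGP_succ.
(* [m] now reads [m - n + n], so induct on the gap, climbing one level at a time. *)
by elim: (m - n) => // k IHk; exact: SSGP_succ.
Qed.
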